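(* Let $\mathcal{L}$ be a finite extremal lattice with a fixed chain of maximal length. The following are equivalent: (i) $\mathcal{L}$ is trim; (ii) every relation $y<z$ in $\mathcal{L}$ is overlapping; (iii) every cover relation $y\lessdot z$ in $\mathcal{L}$ is overlapping.
   Context: For a finite lattice, $\mathcal{J}$, $\mathcal{M}$ are the sets of join- and meet-irreducible elements. A lattice of length $n$ (largest $r$ with a chain $x_0<\dots<x_r$) is extremal if $|\mathcal{J}|=|\mathcal{M}|=n$. Given a chain $\hat0=x_0\lessdot\dots\lessdot x_n=\hat1$ of maximal length, let $j_i$ be the unique join-irreducible with $j_i\le x_i$, $j_i\not\le x_{i-1}$, and $m_i$ the unique meet-irreducible with $m_i\ge x_{i-1}$, $m_i\not\ge x_i$. For $x\in\mathcal{L}$ set $x_\mathcal{J}=\{i\in[n]: j_i\le x\}$ and $x_\mathcal{M}=\{i\in[n]: x\le m_i\}$. A relation $y<z$ is overlapping if $y_\mathcal{M}\cap z_\mathcal{J}\ne\emptyset$. An element $x$ is left modular if $(y\vee x)\wedge z=y\vee(x\wedge z)$ for all $y\le z$; a lattice is left modular if it has a maximal chain of left modular elements; trim means extremal and left modular. *)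

(* Defs.v *)
From HB Require Import structures.
From mathcomp Require Import all_boot all_order.

Set Implicit Arguments.
Unset Strict Implicit.
Unset Printing Implicit Defensive.

Import Order.TTheory.
Local Open Scope order_scope.

(* [finTBLatticeType] is the MathComp structure of nonempty finite lattices. *)
Section FiniteLattice.
Context {d : Order.disp_t} {L : finTBLatticeType d}.
Implicit Types (x y z j m : L) (C : {set L}).

Definition covers y z : bool := (y < z) && [forall w : L, ~~ (y < w < z)].

Definition is_chain C : bool := [forall y in C, forall z in C, y >=< z].

Definition join_irreducible j : bool :=
  (j != \bot) &&
  [forall y : L, forall z : L, (j == y `|` z) ==> (j == y) || (j == z)].

Definition meet_irreducible m : bool :=
  (m != \top) &&
  [forall y : L, forall z : L, (m == y `&` z) ==> (m == y) || (m == z)].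

Definition left_modular x : bool :=
  [forall y : L, forall z : L,
     (y <= z) ==> ((y `|` x) `&` z == y `|` (x `&` z))].

End FiniteLattice.

(* A chain x_0 < ... < x_r has r + 1 elements. *)
Definition lattice_length d (L : finTBLatticeType d) : nat :=
  \max_(C : {set L} | is_chain C) #|C|.-1.

Definition extremal d (L : finTBLatticeType d) : bool :=
  (#|[set j : L | join_irreducible j]| == lattice_length L) &&
  (#|[set m : L | meet_irreducible m]| == lattice_length L).

(* Maximality of the chain is with respect to inclusion. *)
Definition left_modular_lattice d (L : finTBLatticeType d) : bool :=
  [exists C : {set L},
     maxset (@is_chain d L) C && [forall x in C, left_modular x]].

Definition trim d (L : finTBLatticeType d) : bool :=
  extremal L && left_modular_lattice L.

Section Labelling.
Context {d : Order.disp_t} {L : finTBLatticeType d} {n : nat}.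
Implicit Types (c : 'I_n.+1 -> L) (i : 'I_n) (x y z j m : L).

(* Indices are 0-based: i : 'I_n stands for the element i + 1 of {1, .., n},
   so that [lower c i] and [upper c i] are x_{i-1} and x_i in 1-based terms. *)
Definition lower c i : L := c (widen_ord (leqnSn n) i).
Definition upper c i : L := c (lift ord0 i).

Definition maximum_length_chain c : Prop :=
  [/\ n = lattice_length L, c ord0 = \bot, c ord_max = \top &
      forall i, covers (lower c i) (upper c i)].

(* The default values \bot and \top are never used when L is extremal and c
   is a chain of maximum length: see join_labelP and meet_labelP. *)
Definition join_label c i : L :=
  odflt \bot
    [pick j | [&& join_irreducible j, j <= upper c i & ~~ (j <= lower c i)]].

Definition meet_label c i : L :=
  odflt \top
    [pick m | [&& meet_irreducible m, lower c i <= m & ~~ (upper c i <= m)]].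

Definition J_set c x : {set 'I_n} := [set i | join_label c i <= x].
Definition M_set c x : {set 'I_n} := [set i | x <= meet_label c i].

Definition overlapping c y z : bool := M_set c y :&: J_set c z != set0.

Lemma chain_mono c : maximum_length_chain c ->
  forall a b : 'I_n.+1, (a <= b)%N -> c a <= c b.
Proof.
case=> _ _ _ cov a [b ltb] /=.
elim: b ltb => [|b IH] ltb.
  by rewrite leqn0 => /eqP a0; rewrite (_ : a = Ordinal ltb) //; apply: val_inj.
rewrite leq_eqVlt => /orP[/eqP ab|ab].
  by rewrite (_ : a = Ordinal ltb) //; apply: val_inj.
have ltb' : (b < n.+1)%N by apply: ltnW.
apply: le_trans (IH ltb' ab) _.
have /andP[/ltW + _] := cov (Ordinal (ltb : (b < n)%N)).
by rewrite /lower /upper; congr (_ <= _); congr c; apply: val_inj.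
Qed.

Lemma join_labelP c (eL : extremal L) (cP : maximum_length_chain c) i j :
  [&& join_irreducible j, j <= upper c i & ~~ (j <= lower c i)] =
  (j == join_label c i).
Proof.
pose P i j := [&& join_irreducible j, j <= upper c i & ~~ (j <= lower c i)].
have exP k : exists j0, P k j0.
  have [_ _ _ /(_ k)/andP[ltk _]] := cP.
  pose Q z := (z <= upper c k) && ~~ (z <= lower c k).
  have Qu : Q (upper c k) by rewrite /Q lexx lt_geF.
  pose dn z := #|[set w : L | w <= z]|.
  case: (arg_minnP dn Qu) => z /andP[zu zl] zmin.
  have small w : w < z -> w <= lower c k.
    move=> wz; apply/negPn/negP => wl.
    have /zmin : Q w by rewrite /Q wl (le_trans (ltW wz) zu).
    rewrite leqNgt proper_card //; apply/properP; split.
      by apply/subsetP => u; rewrite !inE => /le_trans; apply; apply: ltW.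
    by exists z; rewrite inE ?lexx // lt_geF.
  exists z; rewrite /P zu zl !andbT; apply/andP; split.
    by apply: contraNneq zl => ->; apply: le0x.
  apply/forallP => a; apply/forallP => b; apply/implyP => /eqP zab.
  apply: contraNT zl; rewrite negb_or => /andP[za zb].
  have az : a < z by rewrite lt_neqAle eq_sym za zab leUl.
  have bz : b < z by rewrite lt_neqAle eq_sym zb zab leUr.
  by rewrite zab leUx !small.
have labP k : P k (join_label c k).
  rewrite /join_label; case: pickP => [//|no].
  by have [w Pw] := exP k; move: (no w); rewrite -/(P k w) Pw.
have disj k l w : P k w -> P l w -> (k < l)%N -> False.
  move=> /and3P[_ wk _] /and3P[_ _ /negP wl] kl; apply: wl.
  by apply: le_trans wk _; apply: chain_mono => //=.
have Pinj k l w : P k w -> P l w -> k = l.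
  move=> Pk Pl; apply: val_inj; case: (ltngtP k l) => // kl.
    by case: (disj _ _ _ Pk Pl kl).
  by case: (disj _ _ _ Pl Pk kl).
have linj : injective (join_label c).
  by move=> k l kl; apply: (Pinj k l (join_label c k)); last rewrite kl.
have full : [set join_label c k | k : 'I_n] = [set j : L | join_irreducible j].
  apply/eqP; rewrite eqEcard; apply/andP; split.
    by apply/subsetP => _ /imsetP[k _ ->]; rewrite inE; case/and3P: (labP k).
  have [nE _ _ _] := cP; have /andP[/eqP -> _] := eL.
  by rewrite card_imset // card_ord -nE.
rewrite -/(P i j); apply/idP/eqP => [Pj|->//].
have : j \in [set j : L | join_irreducible j] by rewrite inE; case/and3P: Pj.
rewrite -full => /imsetP[k _ jE]; rewrite jE in Pj *.
by rewrite (Pinj _ _ _ Pj (labP k)).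
Qed.

Lemma meet_labelP c (eL : extremal L) (cP : maximum_length_chain c) i m :
  [&& meet_irreducible m, lower c i <= m & ~~ (upper c i <= m)] =
  (m == meet_label c i).
Proof.
pose P i m := [&& meet_irreducible m, lower c i <= m & ~~ (upper c i <= m)].
have exP k : exists m0, P k m0.
  have [_ _ _ /(_ k)/andP[ltk _]] := cP.
  pose Q z := (lower c k <= z) && ~~ (upper c k <= z).
  have Ql : Q (lower c k) by rewrite /Q lexx lt_geF.
  pose up z := #|[set w : L | z <= w]|.
  case: (arg_minnP up Ql) => z /andP[zl zu] zmin.
  have large w : z < w -> upper c k <= w.
    move=> zw; apply/negPn/negP => wu.
    have /zmin : Q w by rewrite /Q wu (le_trans zl (ltW zw)).
    rewrite leqNgt proper_card //; apply/properP; split.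
      by apply/subsetP => u; rewrite !inE; apply: le_trans; apply: ltW.
    by exists z; rewrite inE ?lexx // lt_geF.
  exists z; rewrite /P zu zl !andbT; apply/andP; split.
    by apply: contraNneq zu => ->; apply: lex1.
  apply/forallP => a; apply/forallP => b; apply/implyP => /eqP zab.
  apply: contraNT zu; rewrite negb_or => /andP[za zb].
  have az : z < a by rewrite lt_neqAle za zab leIl.
  have bz : z < b by rewrite lt_neqAle zb zab leIr.
  by rewrite zab lexI !large.
have labP k : P k (meet_label c k).
  rewrite /meet_label; case: pickP => [//|no].
  by have [w Pw] := exP k; move: (no w); rewrite -/(P k w) Pw.
have disj k l w : P k w -> P l w -> (k < l)%N -> False.
  move=> /and3P[_ _ /negP wk] /and3P[_ wl _] kl; apply: wk.
  by apply: le_trans wl; apply: chain_mono => //=.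
have Pinj k l w : P k w -> P l w -> k = l.
  move=> Pk Pl; apply: val_inj; case: (ltngtP k l) => // kl.
    by case: (disj _ _ _ Pk Pl kl).
  by case: (disj _ _ _ Pl Pk kl).
have linj : injective (meet_label c).
  by move=> k l kl; apply: (Pinj k l (meet_label c k)); last rewrite kl.
have full : [set meet_label c k | k : 'I_n] = [set m : L | meet_irreducible m].
  apply/eqP; rewrite eqEcard; apply/andP; split.
    by apply/subsetP => _ /imsetP[k _ ->]; rewrite inE; case/and3P: (labP k).
  have [nE _ _ _] := cP; have /andP[_ /eqP ->] := eL.
  by rewrite card_imset // card_ord -nE.
rewrite -/(P i m); apply/idP/eqP => [Pm|->//].
have : m \in [set m : L | meet_irreducible m] by rewrite inE; case/and3P: Pm.
rewrite -full => /imsetP[k _ mE]; rewrite mE in Pm *.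
by rewrite (Pinj _ _ _ Pm (labP k)).
Qed.

End Labelling.

(* Main.v *)
Require Import Defs.
From mathcomp Require Import all_boot all_order.

(**
  The relations j_i </= m_i and j_i <= x_i <= x_(k-1) <= m_k for i < k drive
  both directions.

  If all covers overlap and x = x_i failed to be left modular for y <= z, a
  cover in the interval from y \/ (x /\ z) to (y \/ x) /\ z would provide k with
  y \/ (x /\ z) <= m_k and j_k <= (y \/ x) /\ z; then j_k <= x /\ z <= m_k when
  k <= i, and j_k <= y \/ x <= m_k when k > i.

  Conversely, a maximal chain C of left modular elements has, for every cover
  y < z, a step l < l' such that some irreducibles j <= z and m >= y separate
  both y from z and l from l'.  For the covers x_(k-1) < x_k these irreducibles
  are j_k and m_k, so j_k and m_k are separated by the same step of C; distinct
  k have distinct steps, hence for any cover j and m carry the same index.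
*)

Import Order.TTheory.
Local Open Scope order_scope.

(** * Irreducibles separating two elements, and covers *)

Section Cuts.
Context {d : Order.disp_t} {L : finTBLatticeType d}.
Implicit Types (a b x y z l j m : L) (C : {set L}).

Definition join_cut y z j : bool := (j <= z) && ~~ (j <= y).
Definition meet_cut y z m : bool := (y <= m) && ~~ (z <= m).

Lemma exists_minimal (P : pred L) z :
  P z -> exists2 x, P x & forall w, w < x -> ~~ P w.
Proof.
move=> Pz; pose down x := #|[set w : L | w <= x]|.
case: (arg_minnP down Pz) => x Px xmin; exists x => // w wx.
apply/negP => /xmin; rewrite leqNgt proper_card //; apply/properP; split.
  by apply/subsetP => u; rewrite !inE => /le_trans; apply; apply: ltW.
by exists x; rewrite inE ?lexx // lt_geF.
Qed.

(** A minimal element below [a] and not below [b] works: were it a join of two strictly smaller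
    elements, both would lie below [b], hence so would it. *)
Lemma exists_join_irreducible {a b} :
  ~~ (a <= b) -> exists2 j, join_irreducible j & join_cut b a j.
Proof.
move=> ab; have aa : join_cut b a a by rewrite /join_cut lexx.
have [j jP jmin] := exists_minimal (join_cut b a) _ aa.
have [ja jb] := andP jP; exists j => //.
have small w : w < j -> w <= b.
  by move=> wj; have := jmin _ wj; rewrite /join_cut (le_trans (ltW wj) ja) negbK.
apply/andP; split; first by apply: contraNneq jb => ->; apply: le0x.
apply/forallP => u; apply/forallP => v; apply/implyP => /eqP juv.
apply: contraNT jb; rewrite negb_or => /andP[ju jv].
by rewrite juv leUx !small // lt_neqAle eq_sym ?ju ?jv juv ?leUl ?leUr.
Qed.

Lemma exists_cover y z : y < z -> exists2 x, covers y x & x <= z.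
Proof.
move=> yz; have yzz : (y < z) && (z <= z) by rewrite yz lexx.
have [x /andP[yx xz] xmin] := exists_minimal (fun x => (y < x) && (x <= z)) _ yzz.
exists x => //; rewrite /covers yx; apply/forallP => w.
apply/negP => /andP[yw wx]; move: (xmin _ wx).
by rewrite yw (le_trans (ltW wx) xz).
Qed.

Lemma covers_eq {y z w} : covers y z -> y <= w -> w <= z -> w = y \/ w = z.
Proof.
case/andP=> _ /forallP/(_ w); rewrite !lt_neqAle => no yw wz.
move: no; rewrite yw wz !andbT negb_and !negbK => /orP[]/eqP; by [left|right].
Qed.

(** Since [j] is not below [y], the cover forces the join of [y] and [j] to be [z]; an [m] above
    both [y] and [j] would then be above [z]. *)
Lemma cut_nle {y z j m} :
  covers y z -> join_cut y z j -> meet_cut y z m -> ~~ (j <= m).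
Proof.
move=> cov /andP[jz jy] /andP[ym zm]; apply: contra zm => jm.
have yz : y <= z by case/andP: cov => /ltW.
case: (@covers_eq _ _ (y `|` j) cov); rewrite ?leUl ?leUx ?yz ?jz //.
  by move=> E; move: jy; rewrite -E leUr.
by move=> <-; rewrite leUx ym.
Qed.

End Cuts.

(** Duality: join-irreducibles of [L^d] are meet-irreducibles of [L], and [join_cut a b] there is
    [meet_cut b a] here. *)
Lemma exists_meet_irreducible {d} {L : finTBLatticeType d} {a b : L} :
  ~~ (a <= b) -> exists2 m, meet_irreducible m & meet_cut b a m.
Proof. exact: (@exists_join_irreducible _ L^d b a). Qed.

Lemma exists_maximal {d} {L : finTBLatticeType d} (P : pred L) z :
  P z -> exists2 x : L, P x & forall w : L, x < w -> ~~ P w.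
Proof. exact: (@exists_minimal _ L^d P z). Qed.

(** * Steps of a maximal chain and the irreducibles they cut *)

Section LeftModularChain.
Context {d : Order.disp_t} {L : finTBLatticeType d}.
Variable C : {set L}.
Implicit Types (x y z l j m : L).

Definition step l l' : Prop := [/\ l \in C, l' \in C & covers l l'].

Hypothesis maxC : maxset (@is_chain d L) C.

Lemma maxchain_comparable x y : x \in C -> y \in C -> x >=< y.
Proof.
move=> xC yC; have /maxsetp/forall_inP/(_ x xC)/forall_inP := maxC.
exact.
Qed.

Lemma maxchain_mem x : (forall y, y \in C -> x >=< y) -> x \in C.
Proof.
move=> xC; have /maxsetP[_ /(_ (x |: C)) <-] := maxC.
- exact: setU11.
- apply/forall_inP => u /setU1P[->|uC]; apply/forall_inP => v /setU1P[->|vC].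
  + exact: comparablexx.
  + exact: xC.
  + by rewrite comparable_sym xC.
  + exact: maxchain_comparable.
- exact: subsetU1.
Qed.

Lemma step_le l l' x : step l l' -> x \in C -> (x <= l) || (l' <= x).
Proof.
move=> [lC l'C cov] xC.
have [//|] := orP (maxchain_comparable _ _ xC lC); first by move->.
move=> lx; have /orP[xl'|->] := maxchain_comparable _ _ xC l'C; last first.
  by rewrite orbT.
by case: (covers_eq cov lx xl') => ->; rewrite lexx ?orbT.
Qed.

Lemma step_trichotomy {l l' k k'} : step l l' -> step k k' ->
  [\/ (l, l') = (k, k'), l' <= k | k' <= l].
Proof.
move=> sl sk; have [lC l'C /andP[ll' _]] := sl.
have [kC k'C /andP[kk' _]] := sk.
have /orP[kl|] := step_le _ _ _ sl kC; last by constructor 2.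
have /orP[lk|] := step_le _ _ _ sk lC; last by constructor 3.
have E : k = l by apply/eqP; rewrite eq_le kl lk.
constructor 1; subst k; congr (_, _); apply/eqP; rewrite eq_le.
have := step_le _ _ _ sl k'C; rewrite (lt_geF kk') /= => ->.
by have := step_le _ _ _ sk l'C; rewrite (lt_geF ll') /= => ->.
Qed.

(** Of two distinct steps one lies entirely below the other, so an element under the top of the
    lower step is under the bottom of the upper one. *)
Lemma join_cut_step {l l' k k' j} : step l l' -> step k k' ->
  join_cut l l' j -> join_cut k k' j -> (l, l') = (k, k').
Proof.
move=> sl sk /andP[jl' /negP jl] /andP[jk' /negP jk].
case: (step_trichotomy sl sk) => // [lk|kl].
  by case: jk; apply: le_trans lk.
by case: jl; apply: le_trans kl.
Qed.

Lemma meet_cut_step {l l' k k' m} : step l l' -> step k k' ->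
  meet_cut l l' m -> meet_cut k k' m -> (l, l') = (k, k').
Proof.
move=> sl sk /andP[lm /negP l'm] /andP[km /negP k'm].
case: (step_trichotomy sl sk) => // [lk|kl].
  by case: l'm; apply: le_trans km.
by case: k'm; apply: le_trans lm.
Qed.

(** Take the greatest member of [C] outside [P] and the least one inside; an element strictly
    between them is comparable with all of [C], so maximality puts it in [C], a contradiction. *)
Lemma exists_step (P : pred L) :
  {homo P : x y / x <= y >-> x ==> y} -> ~~ P \bot -> P \top ->
  exists l l', [/\ step l l', ~~ P l & P l'].
Proof.
move=> Pup P0 P1.
have C0 : \bot \in C by apply: maxchain_mem => y _; rewrite /(_ >=< _) le0x.
have C1 : \top \in C by apply: maxchain_mem => y _; rewrite /(_ >=< _) lex1 orbT.
have Pl1 : (\top \in C) && P \top by rewrite C1.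
have Pl0 : (\bot \in C) && ~~ P \bot by rewrite C0.
have [l' /andP[l'C Pl'] l'min] := exists_minimal [pred x in C | P x] _ Pl1.
have [l /andP[lC Pl] lmax] := exists_maximal [pred x in C | ~~ P x] _ Pl0.
have le_l u : u \in C -> ~~ P u -> u <= l.
  move=> uC Pu; have [//|lu] := comparable_leP (maxchain_comparable _ _ uC lC).
  by have := lmax u lu; rewrite /= uC Pu.
have l'_le u : u \in C -> P u -> l' <= u.
  move=> uC Pu; have [//|ul] := comparable_leP (maxchain_comparable _ _ l'C uC).
  by have := l'min u ul; rewrite /= uC Pu.
have ll' : l < l'.
  have [l'l|//] := comparable_leP (maxchain_comparable _ _ l'C lC).
  by have := Pup _ _ l'l; rewrite Pl' (negPf Pl).
exists l, l'; split=> //; split=> //; rewrite /covers ll'.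
apply/forallP => w; apply/negP => /andP[lw wl'].
have wC : w \in C.
  apply: maxchain_mem => u uC; rewrite /(_ >=< _).
  have [Pu|Pu] := boolP (P u); first by rewrite (le_trans (ltW wl')) ?l'_le.
  by rewrite (le_trans (le_l _ uC Pu) (ltW lw)) orbT.
have [Pw|Pw] := boolP (P w); first by have := l'_le _ wC Pw; rewrite lt_geF.
by have := le_l _ wC Pw; rewrite lt_geF.
Qed.

Hypothesis lmC : {in C, forall x, left_modular x}.

(* [l] and [l'] are consecutive in [C] with (y \/ l) /\ z = y and
   (y \/ l') /\ z = z. *)
Lemma left_modular_cut y z : covers y z -> exists l l' j m,
  [/\ step l l', join_irreducible j /\ meet_irreducible m,
      join_cut y z j /\ meet_cut y z m & join_cut l l' j /\ meet_cut l l' m].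
Proof.
move=> cov; have [yz _] := andP cov.
have [||| l [l' [sl Pl Pl']]] := exists_step (fun x => z <= y `|` x).
- by move=> u v uv; apply/implyP => /le_trans; apply; apply: leU2.
- by rewrite joinx0 lt_geF.
- by rewrite joinx1 lex1.
have [lC l'C _] := sl.
have lm u : u \in C -> (y `|` u) `&` z = y `|` (u `&` z).
  by move/lmC/forallP/(_ y)/forallP/(_ z); rewrite ltW // => /eqP.
(* [(y \/ l) /\ z] lies between [y] and [z]; it is not [z] by the choice of [l], so it is [y], and
   left modularity rewrites it as [y \/ (l /\ z)]. *)
have lzy : l `&` z <= y.
  have [||E|E] := @covers_eq _ _ _ _ ((y `|` l) `&` z) cov.
  - by rewrite lexI leUl ltW.
  - exact: leIr.
  - by rewrite -E lm // leUr.
  - by move: Pl; rewrite -E leIl.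
have l'zy : ~~ (l' `&` z <= y).
  apply/negP => /join_idPr E; have := lm _ l'C; rewrite joinC in E.
  rewrite E; move/meet_idPr: Pl' => ->; move=> zy; move: yz.
  by rewrite zy ltxx.
(* Choosing [j] under [l' /\ z] but not [y], and [m] over [y \/ l] but not [z], makes each cut both
   covers. *)
have [j jI /andP[]] := exists_join_irreducible l'zy.
rewrite lexI => /andP[jl' jz] jy.
have [m mI /andP[]] := exists_meet_irreducible Pl.
rewrite leUx => /andP[ym lm'] zm.
exists l, l', j, m; split=> //; split; rewrite /join_cut /meet_cut.
- by rewrite jz.
- by rewrite ym.
- by rewrite jl'; apply: contra jy => jl; rewrite (le_trans _ lzy) // lexI jl.
- rewrite lm'; apply: contra zm => l'm.
  by apply: le_trans Pl' _; rewrite leUx ym.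
Qed.

End LeftModularChain.

(** * Labels of the fixed chain *)

Section Labels.
Context {d : Order.disp_t} {L : finTBLatticeType d} {n : nat}.
Variable c : 'I_n.+1 -> L.
Hypotheses (extremal_L : extremal L) (max_c : maximum_length_chain c).

Lemma lower_upper_covers i : covers (lower c i) (upper c i).
Proof. by case: max_c. Qed.

Lemma join_label_cut i : join_cut (lower c i) (upper c i) (join_label c i).
Proof.
have := join_labelP extremal_L max_c i (join_label c i).
by rewrite eqxx => /and3P[_ *]; apply/andP.
Qed.

Lemma meet_label_cut i : meet_cut (lower c i) (upper c i) (meet_label c i).
Proof.
have := meet_labelP extremal_L max_c i (meet_label c i).
by rewrite eqxx => /and3P[_ *]; apply/andP.
Qed.

Lemma join_label_eq i j :
  join_irreducible j -> join_cut (lower c i) (upper c i) j -> j = join_label c i.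
Proof.
by move=> jI jc; apply/eqP; rewrite -(join_labelP extremal_L max_c) jI.
Qed.

Lemma meet_label_eq i m :
  meet_irreducible m -> meet_cut (lower c i) (upper c i) m -> m = meet_label c i.
Proof.
by move=> mI mc; apply/eqP; rewrite -(meet_labelP extremal_L max_c) mI.
Qed.

Lemma join_label_nle i : ~~ (join_label c i <= meet_label c i).
Proof.
exact: cut_nle (lower_upper_covers i) (join_label_cut i) (meet_label_cut i).
Qed.

Lemma join_label_le (i : 'I_n) (a : 'I_n.+1) : (i < a)%N -> join_label c i <= c a.
Proof.
move=> ia; have /andP[+ _] := join_label_cut i; move/le_trans; apply.
exact: chain_mono.
Qed.

Lemma le_meet_label (i : 'I_n) (a : 'I_n.+1) : (a <= i)%N -> c a <= meet_label c i.
Proof.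
move=> ai; have /andP[+ _] := meet_label_cut i; apply: le_trans.
exact: chain_mono.
Qed.

Lemma label_le {i k : 'I_n} : (i < k)%N -> join_label c i <= meet_label c k.
Proof.
(* [c a] is [lower c k]; as [upper c i] has index [i + 1 <= k], it lies below [c a]. *)
move=> ik; pose a := widen_ord (leqnSn n) k.
exact: le_trans (join_label_le i a ik) (le_meet_label k a (leqnn _)).
Qed.

Lemma exists_switch (P : pred L) : ~~ P \bot -> P \top ->
  exists i, ~~ P (lower c i) && P (upper c i).
Proof.
have [_ <- <- _] := max_c => P0 P1; apply/existsP.
apply: contraLR P1 => /existsPn no.
suff H k (kn : (k < n.+1)%N) : ~~ P (c (Ordinal kn)).
  by rewrite (_ : ord_max = Ordinal (ltnSn n)) //; apply: val_inj.
elim: k kn => [|k IH] kn.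
  by rewrite (_ : Ordinal kn = ord0) //; apply: val_inj.
have := no (Ordinal (kn : (k < n)%N)); rewrite /lower /upper.
rewrite (_ : widen_ord _ _ = Ordinal (ltnW kn)); last exact: val_inj.
by rewrite IH (_ : lift _ _ = Ordinal kn) //; apply: val_inj.
Qed.

(** Climbing from bottom to top, the chain gets above [j] at some index, and the label there is
    unique. *)
Lemma join_labelS j : join_irreducible j -> exists i, j = join_label c i.
Proof.
move=> jI; have [||i /andP[jl ju]] := exists_switch (fun x => j <= x).
- by rewrite lex0; case/andP: jI.
- exact: lex1.
by exists i; apply: join_label_eq => //; apply/andP.
Qed.

Lemma meet_labelS m : meet_irreducible m -> exists i, m = meet_label c i.
Proof.
move=> mI; have [||i /andP[/negPn ml mu]] := exists_switch (fun x => ~~ (x <= m)).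
- by rewrite negbK le0x.
- by rewrite le1x; case/andP: mI.
by exists i; apply: meet_label_eq => //; apply/andP.
Qed.

(** * Overlap versus left modularity *)

Lemma overlappingP y z :
  reflect (exists i, y <= meet_label c i /\ join_label c i <= z)
          (overlapping c y z).
Proof.
apply: (iffP (set0Pn _)) => -[i]; rewrite ?inE.
  by case/andP; exists i.
by case=> yi iz; exists i; rewrite !inE yi.
Qed.

Lemma overlapping_of_covers :
  (forall y z, covers y z -> overlapping c y z) ->
  forall y z, y < z -> overlapping c y z.
Proof.
move=> cov y z /exists_cover[x /cov/overlappingP[i [yi ix]] xz].
by apply/overlappingP; exists i; split=> //; apply: le_trans xz.
Qed.

(** The irreducibles that [left_modular_cut] yields for a cover of the chain [c] can only be its two
    labels, so one step of [C] cuts both. *)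
Lemma left_modular_label_cut C i :
  maxset (@is_chain d L) C -> {in C, forall x, left_modular x} ->
  exists l l', [/\ step C l l', join_cut l l' (join_label c i)
                                & meet_cut l l' (meet_label c i)].
Proof.
move=> maxC lmC.
have := left_modular_cut _ maxC lmC _ _ (lower_upper_covers i).
move=> [l [l' [j [m [sl [jI mI] [jc mc] [jl ml]]]]]].
exists l, l'; split=> //.
  by rewrite -(join_label_eq _ _ jI jc).
by rewrite -(meet_label_eq _ _ mI mc).
Qed.

Lemma trim_overlapping :
  trim L -> forall y z, covers y z -> overlapping c y z.
Proof.
case/andP=> _ /existsP[C /andP[maxC /forall_inP lmC]] y z cov.
have [l [l' [j [m [sl [jI mI] [jc mc] [jl ml]]]]]] :=
  left_modular_cut _ maxC lmC _ _ cov.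
have [i jE] := join_labelS _ jI; have [k mE] := meet_labelS _ mI; subst j m.
have [_ _ lcov] := sl.
(* Both labels of [i] share a step of [C], as do both labels of [k]; an irreducible is cut by only
   one step, so both steps are [(l, l')]. *)
have [a [a' [sa ja ma]]] := left_modular_label_cut _ i maxC lmC.
have [b [b' [sb jb mb]]] := left_modular_label_cut _ k maxC lmC.
have [? ?] := join_cut_step _ maxC sl sa jl ja; subst a a'.
have [? ?] := meet_cut_step _ maxC sl sb ml mb; subst b b'.
suff E : i = k.
  apply/overlappingP; exists i; split; last by case/andP: jc.
  by rewrite E; case/andP: mc.
(* Within this common step no [j] label is below an [m] label, yet unequal indices would give such a
   relation through [label_le]. *)
apply: val_inj; case: (ltngtP i k) => // lt.
  by have := cut_nle lcov jl ml; rewrite (label_le lt).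
by have := cut_nle lcov jb ma; rewrite (label_le lt).
Qed.

Lemma overlapping_left_modular :
  (forall y z, y < z -> overlapping c y z) -> forall a, left_modular (c a).
Proof.
move=> ov a; apply/forallP => y; apply/forallP => z; apply/implyP => yz.
have le_pq : y `|` (c a `&` z) <= (y `|` c a) `&` z.
  by rewrite leUx !lexI leUl yz leIr (le_trans (leIl _ _) (leUr _ _)).
rewrite eq_sym; apply/negPn/negP => ne.
have /ov/overlappingP[k []] : y `|` (c a `&` z) < (y `|` c a) `&` z.
  by rewrite lt_neqAle ne.
rewrite leUx lexI => /andP[ym xzm] /andP[jyx jz].
apply/negP: (join_label_nle k); rewrite negbK.
(* Either [join_label c k] is below [c a], hence below [c a /\ z], or [c a] is below
   [meet_label c k], hence so is [y \/ c a]. *)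
have [ka|ak] := ltnP k a.
  by apply: le_trans xzm; rewrite lexI jz join_label_le.
by apply: le_trans jyx _; rewrite leUx ym le_meet_label.
Qed.

Lemma chain_inj : injective c.
Proof.
have lt_c (a b : 'I_n.+1) : (a < b)%N -> c a < c b.
  move=> ab; have an : (a < n)%N by apply: leq_trans ab _; rewrite -ltnS ltn_ord.
  have /andP[lu _] := lower_upper_covers (Ordinal an).
  rewrite (_ : a = widen_ord (leqnSn n) (Ordinal an)); last exact: val_inj.
  apply: lt_le_trans lu _.
  exact: chain_mono.
move=> a b E; apply: val_inj; case: (ltngtP a b) => // /lt_c; by rewrite E ltxx.
Qed.

(** By injectivity [c] has [n + 1] elements, and as [n] is the lattice length no chain has more. *)
Lemma maxset_chain : maxset (@is_chain d L) [set c a | a : 'I_n.+1].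
Proof.
apply/maxsetP; split=> [|B chB sub].
  apply/forall_inP => _ /imsetP[a _ ->]; apply/forall_inP => _ /imsetP[b _ ->].
  have mono := chain_mono max_c.
  by case/orP: (leq_total a b) => /mono; rewrite /(_ >=< _) => ->; rewrite ?orbT.
apply/eqP; rewrite eq_sym eqEcard sub card_imset; last exact: chain_inj.
have := @leq_bigmax_cond _ (@is_chain d L) (fun C => #|C|.-1) B chB.
have [nE _ _ _] := max_c.
by rewrite -/(lattice_length L) -nE card_ord; case: #|B|.
Qed.

Lemma overlapping_trim :
  (forall y z, y < z -> overlapping c y z) -> trim L.
Proof.
move=> ov; rewrite /trim extremal_L; apply/existsP.
exists [set c a | a : 'I_n.+1]; rewrite maxset_chain.
by apply/forall_inP => _ /imsetP[a _ ->]; apply: overlapping_left_modular.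
Qed.

End Labels.

Theorem theorem3p4 (d : Order.disp_t) (L : finTBLatticeType d) (n : nat)
    (c : 'I_n.+1 -> L) (extremal_L : extremal L)
    (max_c : maximum_length_chain c) :
  [<-> trim L;
       forall y z : L, y < z -> overlapping c y z;
       forall y z : L, covers y z -> overlapping c y z].
Proof.
tfae.
- by move=> tr; apply: overlapping_of_covers; apply: trim_overlapping.
- by move=> ov y z /andP[/ov].
- by move=> ov; apply: (overlapping_trim c) => //; apply: overlapping_of_covers.
Qed.
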